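(* Let $I,J$ be intervals in a poset $\mathcal{P}$, let $\{Q_a\}_{a\in\mathcal{A}}$ denote the interval components of $I\cap J$, and let $f=\{f_p:C(I)_p\to C(J)_p\}_{p\in\mathcal{P}}$ be a consistent family of linear maps, with associated scalars denoted $\omega_a(f)$. The following are equivalent: 1. $f$ defines a morphism $C(I)\to C(J)$; 2. for every $a\in\mathcal{A}$ such that $\omega_a(f)\neq0$, the component $Q_a$ is $(I,J)$-valid.
   Context: $\mathbb{K}$ is a fixed field. A subset $I$ of a poset $\mathcal{P}$ is poset-convex if $p,q\in I$, $r\in\mathcal{P}$, $p\le r\le q$ imply $r\in I$; it is poset-connected if for all $p,q\in I$ there are $r_1,\dots,r_{2n}\in I$ with $p\le r_1\ge r_2\le\cdots\le r_{2n-1}\ge r_{2n}\le q$. An interval is a poset-convex, poset-connected subset (possibly empty). A connected component of a subset $U\subset\mathcal{P}$ is a nonempty poset-connected subset of $U$ that is maximal with respect to inclusion. If $U$ is poset-convex (for example $U=I\cap J$ for intervals $I,J$), its connected components are intervals, partition $U$, and are called the interval components of $U$. A $\mathcal{P}$-module is a functor from $\mathcal{P}$ (viewed as a category with a unique morphism $p\to q$ iff $p\le q$) to $\mathbb{K}$-vector spaces; morphisms are natural transformations. For an interval $I$, $C(I)$ is the $\mathcal{P}$-module with $C(I)_p=\mathbb{K}$ if $p\in I$ and $0$ otherwise, and structure maps $\varphi_{C(I)}(p,q)=\mathrm{Id}_{\mathbb{K}}$ if $p,q\in I$ and $0$ otherwise (for $p\le q$). A family $f=\{f_p:C(I)_p\to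 C(J)_p\mid p\in\mathcal{P}\}$ of linear maps is consistent if (1) for every interval component $Q_a$ of $I\cap J$ and all $p,q\in Q_a$, $f_p=f_q$; and (2) for every $p\notin I\cap J$, $f_p$ is the zero map. In this case, for each $a$ there is a scalar $\omega_a(f)\in\mathbb{K}$ such that for every $p\in Q_a$ the map $f_p:\mathbb{K}\to\mathbb{K}$ is multiplication by $\omega_a(f)$. A connected component $Q$ of $I\cap J$ is $(I,J)$-valid if for every $p\in Q$: (1) every $q\in I$ with $q\le p$ satisfies $q\in J$; and (2) every $r\in J$ with $r\ge p$ satisfies $r\in I$. *)

(* Defs.v *)
From HB Require Import structures.
From mathcomp Require Import all_boot all_order all_algebra.
From mathcomp Require Import boolp classical_sets.

Set Implicit Arguments.
Unset Strict Implicit.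
Unset Printing Implicit Defensive.

Import Order.TTheory GRing.Theory.
Local Open Scope classical_set_scope.
Local Open Scope ring_scope.

Section Poset.
Context {d : Order.disp_t} {P : porderType d}.
Implicit Types (I J U Q : set P) (p q r : P).

Definition poset_convex I : Prop :=
  forall p q r, I p -> I q -> (p <= r)%O -> (r <= q)%O -> I r.

(* The zigzag p <= r_1 >= r_2 <= ... <= r_{2n-1} >= r_{2n} <= q is a sequence
   s with s 0 = p and s (2n+1) = q, ascending from even to odd indices.  The
   case n = 0 is p <= q, which is also the zigzag p <= q >= q <= q. *)
Definition poset_connected I : Prop :=
  forall p q, I p -> I q ->
  exists (n : nat) (s : nat -> P),
    [/\ s 0%N = p /\ s n.*2.+1 = q,
        forall i, (1 <= i <= n.*2)%N -> I (s i),
        forall i, (i <= n)%N -> (s i.*2 <= s i.*2.+1)%O &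
        forall i, (i < n)%N -> (s i.*2.+2 <= s i.*2.+1)%O].

Definition is_connected_component U Q : Prop :=
  [/\ Q !=set0, Q `<=` U, poset_connected Q &
      forall Q', poset_connected Q' -> Q' `<=` U -> Q `<=` Q' -> Q' = Q].

Definition valid_component I J Q : Prop :=
  forall p, Q p ->
    (forall q, I q -> (q <= p)%O -> J q) /\
    (forall r, J r -> (p <= r)%O -> I r).

End Poset.

Record poset_interval {d : Order.disp_t} (P : porderType d) : Type := PosetInterval {
  interval_set :> set P;
  interval_convex : poset_convex interval_set;
  interval_connected : poset_connected interval_set
}.

Record pmodule (K : fieldType) {d : Order.disp_t} (P : porderType d) : Type :=
  PModule {
    pspace :> P -> lmodType K;
    pmap : forall p q, (p <= q)%O -> {linear pspace p -> pspace q};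
    pmap_id : forall p (h : (p <= p)%O) x, pmap h x = x;
    pmap_comp : forall p q r (hpq : (p <= q)%O) (hqr : (q <= r)%O)
      (hpr : (p <= r)%O) x, pmap hpr x = pmap hqr (pmap hpq x)
  }.

Definition pmodule_family (K : fieldType) {d : Order.disp_t} {P : porderType d}
  (M N : pmodule K P) : Type := forall p, {linear M p -> N p}.

Definition is_pmorphism (K : fieldType) {d : Order.disp_t} {P : porderType d}
  (M N : pmodule K P) (f : pmodule_family M N) : Prop :=
  forall p q (h : (p <= q)%O) (x : M p),
    pmap N h (f p x) = f q (pmap M h x).

Section IntervalModule.
Variable K : fieldType.

Definition line_or_zero (b : bool) : lmodType K :=
  if b then (K^o : lmodType K) else ('rV[K]_0 : lmodType K).

Definition line_or_zero_map (b c : bool) :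
    {linear line_or_zero b -> line_or_zero c} :=
  match b, c with
  | true, true => idfun
  | _, _ => \0
  end.

(* For b = true these two maps are the identity of K; they only serve to view
   the spaces at different points of a component as the same space K. *)
Definition of_scalar (b : bool) : {linear K^o -> line_or_zero b} :=
  line_or_zero_map true b.
Definition to_scalar (b : bool) : {linear line_or_zero b -> K^o} :=
  line_or_zero_map b true.

Lemma line_or_zero0 (x y : line_or_zero false) : x = y.
Proof. by rewrite /= [x]thinmx0 [y]thinmx0. Qed.

Context {d : Order.disp_t} {P : porderType d}.
Implicit Types I J : poset_interval P.

Lemma interval_module_id I (p : P) (h : (p <= p)%O)
  (x : line_or_zero (p \in (I : set P))) : line_or_zero_map _ _ x = x.
Proof. by case: (p \in _) x => // x; exact: line_or_zero0. Qed.

Lemma interval_module_comp I (p q r : P) (hpq : (p <= q)%O) (hqr : (q <= r)%O)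
  (hpr : (p <= r)%O) (x : line_or_zero (p \in (I : set P))) :
  line_or_zero_map _ (r \in (I : set P)) x =
  line_or_zero_map _ _ (line_or_zero_map _ (q \in (I : set P)) x).
Proof.
have hq : p \in (I : set P) -> r \in (I : set P) -> q \in (I : set P).
  by rewrite !inE => Ip Ir; exact: interval_convex Ip Ir hpq hqr.
case: (p \in _) x hq; case: (q \in _); case: (r \in _) => //= x hq.
by have := hq isT isT.
Qed.

(* C(I) *)
Definition interval_module I : pmodule K P :=
  @PModule K d P (fun p => line_or_zero (p \in (I : set P)))
    (fun p q _ => line_or_zero_map _ _)
    (@interval_module_id I) (@interval_module_comp I).

Section Family.
Variables (I J : poset_interval P) (f : pmodule_family (interval_module I) (interval_module J)).

(* For p in I `&` J this is f_p itself, read as a map from K to K. *)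
Definition fiber (p : P) (x : K) : K :=
  to_scalar (p \in (J : set P)) (f p (of_scalar (p \in (I : set P)) x)).

Definition consistent : Prop :=
  (forall Q, is_connected_component (I `&` J) Q ->
     forall p q, Q p -> Q q -> fiber p =1 fiber q) /\
  (forall p, ~ (I `&` J) p -> forall x, f p x = 0).

Definition is_omega (Q : set P) (w : K) : Prop :=
  forall p, Q p -> forall x, fiber p x = w * x.

Definition omega (Q : set P) : K := xget 0 [set w | is_omega Q w].

Lemma fiberZ p x : fiber p x = fiber p 1 * x.
Proof.
rewrite mulrC -[LHS](_ : fiber p (x *: (1 : K^o)) = _); last first.
  by rewrite /GRing.scale /= mulr1.
by rewrite /fiber !linearZ.
Qed.

Lemma omegaP Q : consistent -> is_connected_component (I `&` J) Q ->
  is_omega Q (omega Q).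
Proof.
move=> [cf _] cQ; apply: (@xgetPex _ 0 [set w | is_omega Q w]).
have [[q Qq] _ _ _] := cQ; exists (fiber q 1) => p Qp x.
by rewrite (cf Q cQ p q Qp Qq) fiberZ.
Qed.

Lemma omega_unique Q w : consistent -> is_connected_component (I `&` J) Q ->
  is_omega Q w -> omega Q = w.
Proof.
move=> cf cQ wQ; have [[q Qq] _ _ _] := cQ.
by have := omegaP cf cQ Qq 1; rewrite (wQ q Qq) !mulr1.
Qed.

End Family.
End IntervalModule.

(* Main.v *)
Require Import Defs.
From HB Require Import structures.
From mathcomp Require Import all_boot all_order all_algebra.
From mathcomp Require Import boolp classical_sets.
Import Order.TTheory GRing.Theory.
Local Open Scope classical_set_scope.
Local Open Scope ring_scope.

(** Write [f_p] for the endomorphism [fiber f p] of K.  In the naturality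
    square of f over p <= q, both paths start in C(I)_p and end in C(J)_q, so
    the square commutes trivially unless p lies in I and q lies in J; in that
    case both paths are maps from K to K, and they are [f_p] and [f_q]
    ([is_pmorphismE]).  Hence f is a morphism exactly when [f_p = f_q] for all
    p <= q with p in I and q in J.

    Since [f_p] vanishes for p outside I `&` J and is multiplication by
    [omega f Q] for p in a component Q, this reads as follows.  If f is a
    morphism and Q has a nonzero scalar, then a point of I below Q carries a
    nonzero [f_q], so it lies in J; dually for a point of J above Q.
    Conversely, let p <= q with p in I and q in J.  If one of the two points
    lies in a component with nonzero scalar, validity puts the other one into
    I `&` J as well, and two comparable points of I `&` J lie in one component
    ([comparable_in_component]), where f is constant.  Otherwise [f_p] and
    [f_q] are both zero. *)

Section Zigzag.
Context {d : Order.disp_t} {P : porderType d}.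
Implicit Types (U S T Q : set P) (p q r : P).

(** [poset_connected S] is convertible to: [zigzag S] relates any two points
    of S. *)
Definition zigzag S p q : Prop :=
  exists (n : nat) (s : nat -> P),
    [/\ s 0%N = p /\ s n.*2.+1 = q,
        forall i, (1 <= i <= n.*2)%N -> S (s i),
        forall i, (i <= n)%N -> (s i.*2 <= s i.*2.+1)%O &
        forall i, (i < n)%N -> (s i.*2.+2 <= s i.*2.+1)%O].

Lemma zigzagS S T p q : S `<=` T -> zigzag S p q -> zigzag T p q.
Proof.
move=> ST [n [s [e Ss up down]]]; exists n, s; split=> // i hi.
exact/ST/Ss.
Qed.

Lemma zigzag_le S p q : (p <= q)%O -> zigzag S p q.
Proof.
move=> pq; exists 0%N, (fun i => if i is 0%N then p else q); split=> //.
- by case.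
- by case.
Qed.

Lemma zigzag_ge S p q : S p -> S q -> (q <= p)%O -> zigzag S p q.
Proof.
(* The zigzag is p <= p >= q <= q. *)
move=> Sp Sq qp; exists 1%N, (fun i => if (i <= 1)%N then p else q).
by split=> //; [case=> [|[|[|]]] | case=> [|[|]] | case].
Qed.

(** The two zigzags meet in ... <= p <= ..., two consecutive ascents, which
    merge into one; the common point p itself disappears from the sequence. *)
Lemma zigzag_trans S q p r : zigzag S q p -> zigzag S p r -> zigzag S q r.
Proof.
move=> [n [s [[s0 s1] Ss sup sdown]]] [m [t [[t0 t1] St tup tdown]]].
exists (n + m)%N, (fun i => if (i <= n.*2)%N then s i else t (i - n.*2)%N).
have shift k : ((n + k).*2.+1 - n.*2 = k.*2.+1)%N by rewrite doubleD -addnS addKn.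
split.
- by rewrite leq0n leqNgt ltnS leq_double leq_addr shift.
- move=> i /andP[i1]; rewrite doubleD => inm; case: leqP => hi.
    by apply: Ss; rewrite i1.
  by apply: St; rewrite subn_gt0 hi leq_subLR.
- move=> i inm; rewrite leq_double ltn_double; case: ltngtP => [hi|hi|->].
  + exact/sup/ltnW.
  + have -> : i = (n + (i - n))%N by rewrite subnKC // ltnW.
    rewrite shift doubleD addKn; apply: tup.
    by rewrite leq_subLR.
  + (* the junction of the two sequences *)
    rewrite subSnn; apply: le_trans (sup n (leqnn n)) _.
    by rewrite s1 -t0; apply: (tup 0%N).
- move=> i inm; rewrite -doubleS leq_double ltn_double; case: ltnP => hi.
    by rewrite doubleS; apply: sdown.
  have -> : i = (n + (i - n))%N by rewrite subnKC.
  rewrite shift -addnS doubleD addKn doubleS; apply: tdown.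
  by rewrite ltn_subLR.
Qed.

(** Connectedness of S requires zigzags inside S, so collecting the points
    joined to p by a zigzag in U would need an extra argument; a union of
    connected sets makes maximality immediate. *)
Definition component U p : set P :=
  [set q | exists S, [/\ poset_connected S, S `<=` U, S p & S q]].

Lemma component_is_connected_component U p :
  component U p p -> is_connected_component U (component U p).
Proof.
move=> pp; split.
- by exists p.
- by move=> q [S [_ SU _ /SU]].
- move=> q r [S [cS SU Sp Sq]] [T [cT TU Tp Tr]].
  apply: (zigzag_trans _ _ p).
    by apply: (zigzagS _ _ _ _ _ (cS _ _ Sq Sp)) => x Sx; exists S.
  by apply: (zigzagS _ _ _ _ _ (cT _ _ Tp Tr)) => x Tx; exists T.
- move=> Q cQ QU subQ; apply/seteqP; split=> // q Qq.
  by exists Q; split=> //; apply: subQ.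
Qed.

Lemma comparable_in_component U p q : U p -> U q -> (p <= q)%O ->
  exists2 Q, is_connected_component U Q & Q p /\ Q q.
Proof.
move=> Up Uq pq.
have cpq : poset_connected [set p; q].
  move=> x y [] -> [] ->; try exact: zigzag_le.
  by apply: zigzag_ge => //=; [right | left].
have pqU : [set p; q] `<=` U by move=> x [] ->.
have comp x : [set p; q] x -> component U p x.
  by move=> hx; exists [set p; q]; split=> //; left.
exists (component U p).
  by apply: component_is_connected_component; apply: comp; left.
by split; apply: comp; [left | right].
Qed.

End Zigzag.

Section Morphism.
Context {K : fieldType} {d : Order.disp_t} {P : porderType d}.
Context {I J : poset_interval P}.
Variable f : pmodule_family (interval_module K I) (interval_module K J).

(** A single naturality square, with the four membership conditions
    abstracted to booleans. *)
Lemma line_or_zero_squareE (b b' c c' : bool)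
    (u : {linear line_or_zero K b -> line_or_zero K c})
    (v : {linear line_or_zero K b' -> line_or_zero K c'}) :
  (forall x, line_or_zero_map K c c' (u x) = v (line_or_zero_map K b b' x)) <->
  (b -> c' -> forall x, to_scalar K c (u (of_scalar K b x)) =
                        to_scalar K c' (v (of_scalar K b' x))).
Proof.
case: c' v => v; last by split=> // _ x; apply: line_or_zero0.
case: b u => u.
  by split=> [nat _ _ x|nat x]; [exact: nat | exact: nat].
split=> // _ x; have -> : x = 0 by apply: line_or_zero0.
by rewrite !linear0.
Qed.

Lemma is_pmorphismE : is_pmorphism f <->
  forall p q, (p <= q)%O -> (I : set P) p -> (J : set P) q ->
    fiber f p =1 fiber f q.
Proof.
split=> [nat p q pq Ip Jq|nat p q pq].
  have /line_or_zero_squareE := nat p q pq.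
  by apply; rewrite inE.
by apply/line_or_zero_squareE; rewrite !inE => Ip Jq; apply: nat.
Qed.

Hypothesis cf : consistent f.

Lemma fiber_eq0 p : ~ ((I : set P) `&` J) p -> forall x, fiber f p x = 0.
Proof. by move=> np x; rewrite /fiber cf.2 // linear0. Qed.

Lemma fiber1_neq0 {p} : fiber f p 1 != 0 -> ((I : set P) `&` J) p.
Proof. by move=> fp; apply: contrapT => /fiber_eq0 f0; rewrite f0 eqxx in fp. Qed.

Lemma fiber1_omega {Q p} : is_connected_component (I `&` J) Q -> Q p ->
  fiber f p 1 = omega f Q.
Proof. by move=> cQ Qp; rewrite (omegaP cf cQ Qp) mulr1. Qed.

(** Naturality transports the nonzero scalar from a point of Q to any point of
    I below it or of J above it, and a nonzero fiber forces membership in both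
    intervals. *)
Lemma pmorphism_valid Q : is_pmorphism f -> is_connected_component (I `&` J) Q ->
  omega f Q != 0 -> valid_component I J Q.
Proof.
move=> /is_pmorphismE nat cQ w0 p Qp; have [_ /(_ p Qp)[Ip Jp] _ _] := cQ.
split=> [q Iq qp|r Jr pr].
  by apply: proj2 (fiber1_neq0 _); rewrite (nat _ _ qp Iq Jp) (fiber1_omega cQ Qp).
by apply: proj1 (fiber1_neq0 _); rewrite -(nat _ _ pr Ip Jr) (fiber1_omega cQ Qp).
Qed.

(** Validity is a condition on each point of a component; stating it for one
    point with nonzero fiber removes the component from the case analysis
    that follows. *)
Lemma valid_of_fiber1_neq0 p :
  (forall Q : set P, is_connected_component (I `&` J) Q ->
     omega f Q != 0 -> valid_component I J Q) ->
  fiber f p 1 != 0 -> valid_component I J [set p].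
Proof.
move=> valid fp _ ->; have Up := fiber1_neq0 fp.
have [Q cQ [Qp _]] := comparable_in_component _ _ _ Up Up (lexx p).
by apply: (valid Q cQ) => //; rewrite -(fiber1_omega cQ Qp).
Qed.

Lemma valid_pmorphism :
  (forall Q : set P, is_connected_component (I `&` J) Q ->
     omega f Q != 0 -> valid_component I J Q) -> is_pmorphism f.
Proof.
move=> valid; apply/is_pmorphismE => p q pq Ip Jq.
suff e1 : fiber f p 1 = fiber f q 1.
  by move=> x; rewrite fiberZ e1 -fiberZ.
have same : ((I : set P) `&` J) p -> ((I : set P) `&` J) q ->
    fiber f p 1 = fiber f q 1.
  move=> Up Uq; have [Q cQ [Qp Qq]] := comparable_in_component _ _ _ Up Uq pq.
  exact: cf.1 cQ _ _ Qp Qq 1.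
have [fp0|fp] := eqVneq (fiber f p 1) 0; last first.
  apply: same; first exact: fiber1_neq0.
  split=> //.
  exact: (valid_of_fiber1_neq0 _ valid fp p erefl).2 _ Jq pq.
have [fq0|fq] := eqVneq (fiber f q 1) 0; first by rewrite fp0 fq0.
apply: same; last exact: fiber1_neq0.
split=> //.
exact: (valid_of_fiber1_neq0 _ valid fq q erefl).1 _ Ip pq.
Qed.

End Morphism.

Theorem proposition3p4 (K : fieldType) (d : Order.disp_t) (P : porderType d)
  (I J : poset_interval P)
  (f : pmodule_family (interval_module K I) (interval_module K J)) :
  consistent f ->
  (is_pmorphism f <->
   forall Q : set P, is_connected_component (I `&` J) Q ->
     omega f Q != 0 -> valid_component I J Q).
Proof.
move=> cf; split=> [nat Q|]; last exact: valid_pmorphism.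
exact: pmorphism_valid.
Qed.
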